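(* For a topological space $X$, the following statements are equivalent: (i) $B_1(X)=B_1^*(X)$. (ii) $B_1(X)$ with the $u_B$-topology is a topological ring. (iii) The set of all units in $B_1(X)$ is an open set in the $u_B$-topology.
   Context: A Baire one function on a topological space $X$ is a function $f:X\to\mathbb{R}$ that is the pointwise limit of a sequence of continuous real-valued functions on $X$. $B_1(X)$ is the commutative ring, under pointwise operations, of all Baire one functions on $X$, and $B_1^*(X)$ is its subring of bounded functions. The $u_B$-topology on $B_1(X)$ is the topology in which, for each $f\in B_1(X)$, the sets $U(f,\epsilon)=\{g\in B_1(X): |f(x)-g(x)|\le\epsilon \text{ for all } x\in X\}$, $\epsilon>0$, form a base for the neighbourhood system at $f$. *)

(* Defs.v *)
From HB Require Import structures.
From mathcomp Require Import all_boot all_order all_algebra.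
From mathcomp Require Import all_classical all_reals all_analysis.

Set Implicit Arguments.
Unset Strict Implicit.
Unset Printing Implicit Defensive.

Import Order.TTheory GRing.Theory Num.Theory.
Import numFieldNormedType.Exports.

Local Open Scope classical_set_scope.
Local Open Scope ring_scope.

Definition baire_one (X : topologicalType) (R : realType) (f : X -> R) : Prop :=
  exists u : nat -> X -> R,
    (forall n, continuous (u n)) /\ (forall x, u n x @[n --> \oo] --> f x).

Definition baire_one_pred (X : topologicalType) (R : realType) :
    {pred X -> R} :=
  fun f => `[< baire_one f >].

Section SubringClosed.
Variables (X : topologicalType) (R : realType).

Lemma baire_one_subring_closed : subring_closed (@baire_one_pred X R).
Proof.
split.
- apply/asboolP; exists (fun _ => cst 1); split => [n|x].
    exact: cst_continuous.
  exact: cvg_cst.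
- move=> f g /asboolP[u [uc uf]] /asboolP[v [vc vg]].
  apply/asboolP; exists (fun n x => u n x - v n x); split => [n x|x].
    by apply: cvgB; [exact: uc|exact: vc].
  by apply: cvgB; [exact: uf|exact: vg].
- move=> f g /asboolP[u [uc uf]] /asboolP[v [vc vg]].
  apply/asboolP; exists (fun n x => u n x * v n x); split => [n x|x].
    by apply: cvgM; [exact: uc|exact: vc].
  by apply: cvgM; [exact: uf|exact: vg].
Qed.

HB.instance Definition _ :=
  GRing.isSubringClosed.Build (X -> R) (@baire_one_pred X R)
    baire_one_subring_closed.

End SubringClosed.

(* The ring B_1(X), with the pointwise operations inherited from X -> R. *)
Record B1 (X : topologicalType) (R : realType) := MkB1 {
  B1_fun :> X -> R;
  B1_funP : B1_fun \in @baire_one_pred X R }.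

HB.instance Definition _ (X : topologicalType) (R : realType) :=
  [isSub for @B1_fun X R].
HB.instance Definition _ (X : topologicalType) (R : realType) :=
  [Choice of B1 X R by <:].
HB.instance Definition _ (X : topologicalType) (R : realType) :=
  GRing.SubChoice_isSubComPzRing.Build (X -> R) (@baire_one_pred X R) (B1 X R)
    (@baire_one_subring_closed X R).

Definition B1_bounded (X : topologicalType) (R : realType) : set (B1 X R) :=
  [set f | bounded_fun (f : X -> R)].

Definition uB_ball (X : topologicalType) (R : realType) (f : B1 X R) (e : R) :
    set (B1 X R) :=
  [set g | forall x, `|f x - g x| <= e].

Section UBTopology.
Variables (X : topologicalType) (R : realType).

Definition uB_nbhs (f : B1 X R) : set_system (B1 X R) :=
  [set A | exists2 e : R, 0 < e & uB_ball f e `<=` A].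

HB.instance Definition _ := hasNbhs.Build (B1 X R) uB_nbhs.

Let uB_nbhs_filter (f : B1 X R) : ProperFilter (nbhs f).
Proof.
split.
  move=> [e e0 /(_ f)]; apply=> x.
  by rewrite subrr normr0 ltW.
split.
- by exists 1.
- move=> A B [e e0 eA] [d d0 dB]; exists (Num.min e d).
    by rewrite lt_min e0 d0.
  move=> g fg; split; [apply: eA|apply: dB] => x;
    by have := fg x; rewrite le_min => /andP[].
- by move=> A B AB [e e0 eA]; exists e => //; exact: subset_trans eA AB.
Qed.

Let uB_nbhs_singleton (f : B1 X R) (A : set (B1 X R)) : nbhs f A -> A f.
Proof. by move=> [e e0]; apply=> x; rewrite subrr normr0 ltW. Qed.

Let uB_nbhs_nbhs (f : B1 X R) (A : set (B1 X R)) :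
  nbhs f A -> nbhs f (nbhs^~ A).
Proof.
move=> [e e0 eA]; exists (e / 2); first by rewrite divr_gt0.
move=> g fg; exists (e / 2); first by rewrite divr_gt0.
move=> h gh; apply: eA => x.
rewrite (splitr e) -(subrKA (g x)); apply: le_trans (ler_normD _ _) _.
exact: lerD.
Qed.

HB.instance Definition _ := Nbhs_isNbhsTopological.Build (B1 X R)
  uB_nbhs_filter uB_nbhs_singleton uB_nbhs_nbhs.

End UBTopology.

#[short(type="preTopologicalPzRingType")]
HB.structure Definition PreTopologicalPzRing :=
  {A of Topological A & GRing.PzRing A}.

HB.instance Definition _ (X : topologicalType) (R : realType) :=
  GRing.PzRing.on (B1 X R).

Definition topological_ring (A : preTopologicalPzRingType) : Prop :=
  [/\ continuous (fun p : A * A => p.1 + p.2),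
      continuous (fun a : A => - a) &
      continuous (fun p : A * A => p.1 * p.2)].

(* [GRing.unit] requires a nontrivial ring, whereas [B1 X R] is the zero ring
   when [X] is empty. *)
Definition ring_units (A : comPzRingType) : set A :=
  [set a | exists b : A, a * b = 1].

(* Main.v *)
(** In the [u_B]-topology a product is only controlled by the sup norms of its
    factors: if [f] is unbounded, then [f * e] does not tend to [0] with the
    constant [e], so continuity of the product forces boundedness.  The units
    are the nowhere vanishing functions.  If every function is bounded, a unit
    is bounded away from [0], hence so are its neighbours.  If [f] is unbounded,
    the unit [k = 1 / (1 + f^2)] has arbitrarily small values, and subtracting
    from [k] one of its values gives a non-unit close to [k]. *)
Require Import Defs.
From mathcomp Require Import all_boot all_order all_algebra.
From mathcomp Require Import all_classical all_reals all_analysis.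
From mathcomp Require Import ring lra.

Set Implicit Arguments.
Unset Strict Implicit.
Unset Printing Implicit Defensive.

Import Order.TTheory GRing.Theory Num.Theory.
Import numFieldNormedType.Exports.

Local Open Scope classical_set_scope.
Local Open Scope ring_scope.

Section B1Theory.
Variables (X : topologicalType) (R : realType).
Implicit Types (f g : B1 X R) (c : R).

Lemma B1_funD f g x : (f + g) x = f x + g x. Proof. by []. Qed.
Lemma B1_funN f x : (- f) x = - f x. Proof. by []. Qed.
Lemma B1_funM f g x : (f * g) x = f x * g x. Proof. by []. Qed.
Lemma B1_fun0 x : (0 : B1 X R) x = 0. Proof. by []. Qed.
Lemma B1_fun1 x : (1 : B1 X R) x = 1. Proof. by []. Qed.

Definition B1_funE := (B1_funD, B1_funN, B1_funM, B1_fun0, B1_fun1).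

Lemma B1_ext f g : (forall x, f x = g x) -> f = g.
Proof. by move=> fg; apply: val_inj; apply/funext. Qed.

Lemma baire_one_cst c : (cst c : X -> R) \in @baire_one_pred X R.
Proof.
apply/asboolP; exists (fun=> cst c); split=> [n|x]; first exact: cst_continuous.
exact: cvg_cst.
Qed.

Definition B1_cst c : B1 X R := MkB1 (baire_one_cst c).

(* [u / (u ^ 2 + 1 / (n + 1))] is continuous even where [u] vanishes. *)
Lemma baire_one_inv f : (forall x, f x != 0) ->
  (fun x => (f x)^-1) \in @baire_one_pred X R.
Proof.
move=> f0; have /asboolP[u [uc uf]] := B1_funP f; apply/asboolP.
exists (fun n x => u n x / (u n x * u n x + n.+1%:R^-1)); split=> [n x|x].
  have d0 : u n x * u n x + n.+1%:R^-1 != 0.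
    by rewrite gt_eqF// ltr_wpDl ?invr_gt0// -expr2 sqr_ge0.
  apply: cvgM; first exact: uc.
  apply: cvgV => //; apply: cvgD; last exact: cvg_cst.
  by apply: cvgM; exact: uc.
(* The limit takes the shape of the approximants, the [0] being the limit of [n.+1%:R^-1]. *)
rewrite (_ : (f x)^-1 = f x / (f x * f x + 0)); last first.
  by rewrite addr0 invfM mulrA divff// mul1r.
apply: cvgM; first exact: uf.
apply: cvgV; first by rewrite addr0 mulf_neq0.
apply: cvgD; first by apply: cvgM; exact: uf.
exact: cvg_harmonic.
Qed.

Lemma ring_units_B1P f : ring_units f <-> forall x, f x != 0.
Proof.
split=> [[g fg] x|f0].
  apply: contra_neq (oner_neq0 R) => fx0.
  by rewrite -(B1_fun1 x) -fg B1_funM fx0 mul0r.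
exists (MkB1 (baire_one_inv f0)); apply: B1_ext => x.
by rewrite B1_funM /= divff.
Qed.

Lemma B1_boundedP f : B1_bounded f <-> exists M, forall x, `|f x| <= M.
Proof.
split=> [[M [_ Mf]]|[M Mf]].
  (* [bounded_fun] only yields bounds strictly above [M]. *)
  by exists (M + 1) => x; apply: (Mf (M + 1)) => //; rewrite ltrDl.
exists M; split; first exact: num_real.
by move=> N MN x _; exact: le_trans (Mf x) (ltW MN).
Qed.

Lemma nbhs_uB_ball f c : 0 < c -> nbhs f (uB_ball f c).
Proof. by move=> c0; exists c. Qed.

Lemma B1_addr_continuous : continuous (fun p : B1 X R * B1 X R => p.1 + p.2).
Proof.
move=> [f g] A [e e0 eA].
have e20 : 0 < e / 2 by rewrite divr_gt0.
exists (uB_ball f (e / 2), uB_ball g (e / 2)).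
  by split; exact: nbhs_uB_ball.
move=> [f' g'] /= [ff' gg']; apply: eA => x; rewrite !B1_funE opprD addrACA.
by rewrite (splitr e) (le_trans (ler_normD _ _))// lerD.
Qed.

Lemma B1_oppr_continuous : continuous (fun f : B1 X R => - f).
Proof.
move=> f A [e e0 eA]; exists e => // g fg; apply: eA => x.
by rewrite !B1_funE -opprD normrN.
Qed.

Lemma B1_mulr_continuous : (forall f, B1_bounded f) ->
  continuous (fun p : B1 X R * B1 X R => p.1 * p.2).
Proof.
move=> bd [f g] A [e e0 eA].
have [M fM] := (B1_boundedP f).1 (bd f).
have [N gN] := (B1_boundedP g).1 (bd g).
(* [K] bounds [g] and, since [d <= 1], also every [f'] within [d] of [f]. Each of the two terms of
   the difference of products is then at most [d * K <= e / 2]. *)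
pose K := `|M| + `|N| + 1.
have K0 : 0 < K by rewrite ltr_wpDl// addr_ge0.
pose d := Num.min 1 (e / (2 * K)).
have d0 : 0 < d by rewrite lt_min ltr01 divr_gt0// mulr_gt0.
have dK : d * K <= e / 2.
  rewrite -ler_pdivlMr// (_ : e / 2 / K = e / (2 * K)); last by rewrite invfM mulrA.
  by rewrite ge_min lexx orbT.
have d1 : d <= 1 by rewrite ge_min lexx.
exists (uB_ball f d, uB_ball g d); first by split; exact: nbhs_uB_ball.
move=> [f' g'] /= [ff' gg']; apply: eA => x; rewrite !B1_funE.
have -> : f x * g x - f' x * g' x =
    (f x - f' x) * g x + f' x * (g x - g' x) by ring.
have gK : `|g x| <= K.
  by rewrite (le_trans (gN x))// (le_trans (ler_norm N))// /K addrAC ler_wpDl// addr_ge0.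
have f'K : `|f' x| <= K.
  have -> : f' x = f x - (f x - f' x) by ring.
  rewrite (le_trans (ler_normB _ _))// /K.
  have := fM x; have := ff' x; have := ler_norm M; have := normr_ge0 N.
  rewrite /=; lra.
rewrite (le_trans (ler_normD _ _))// (splitr e) lerD// normrM.
  by apply: le_trans dK; rewrite ler_pM.
by apply: le_trans dK; rewrite mulrC ler_pM.
Qed.

Lemma B1_mulr_continuous_bounded :
  continuous (fun p : B1 X R * B1 X R => p.1 * p.2) ->
  forall f, B1_bounded f.
Proof.
move=> mulc f; apply/B1_boundedP.
have : nbhs (f * 0) (uB_ball (f * 0) 1) by exact: nbhs_uB_ball.
move=> /(mulc (f, 0)) [[A B] /= [Af [e e0 eB]] AB].
(* The constant [e] lies in the ball of radius [e] around [0], so [f * e] stays within [1] of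
   [f * 0 = 0]. *)
exists e^-1 => x.
have Be : B (B1_cst e).
  by apply: eB => y; rewrite B1_fun0 /= sub0r normrN gtr0_norm.
have : `|(f * 0) x - (f * B1_cst e) x| <= 1.
  exact: (AB (f, B1_cst e) (conj (nbhs_singleton Af) Be) x).
rewrite !B1_funM B1_fun0 mulr0 sub0r normrN normrM (gtr0_norm e0).
by rewrite -ler_pdivlMr ?div1r.
Qed.

Lemma open_ring_units_B1 : (forall f, B1_bounded f) ->
  open (@ring_units (B1 X R)).
Proof.
move=> bd; rewrite openE => f [h fh].
have [M hM] := (B1_boundedP h).1 (bd h).
pose K := `|M| + 1.
have K0 : 0 < K by rewrite ltr_wpDl.
(* As [f * h = 1] and [h] is bounded by [K], [f] is at least [K^-1] in absolute value. A zero of [g]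
   at [x] would force [f x] down to half of that, giving [1 <= 1 / 2]. *)
exists (K^-1 / 2); first by rewrite divr_gt0// invr_gt0.
move=> g fg; apply/ring_units_B1P => x; apply/eqP => gx0.
have := fg x; rewrite gx0 subr0 => fx.
have : `|f x| * `|h x| <= K^-1 / 2 * K.
  by rewrite ler_pM// (le_trans (hM x))// (le_trans (ler_norm M))// ler_wpDr.
rewrite -normrM -B1_funM fh B1_fun1 normr1 mulrAC mulVf ?gt_eqF//.
lra.
Qed.

Lemma open_ring_units_B1_bounded : open (@ring_units (B1 X R)) ->
  forall f, B1_bounded f.
Proof.
move=> uo f; apply/B1_boundedP.
have q1 x : 1 <= (1 + f * f) x by rewrite !B1_funE lerDl -expr2 sqr_ge0.
have q0 x : 0 < (1 + f * f) x := lt_le_trans ltr01 (q1 x).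
pose k := MkB1 (baire_one_inv (fun x => lt0r_neq0 (q0 x))).
have [e e0 eU] : nbhs k (@ring_units (B1 X R)).
  apply: open_nbhs_nbhs; split=> //; apply/ring_units_B1P => x.
  by rewrite invr_neq0// gt_eqF.
(* Above this bound [|f x|] exceeds [1], so its square exceeds [e^-1] and [k x] is at most [e]. *)
exists (1 + e^-1) => x; rewrite leNgt; apply/negP => fx.
have kxe : k x <= e.
  rewrite -[leRHS]invrK lef_pV2 ?posrE ?invr_gt0//.
  rewrite !B1_funE -expr2 -real_normK ?num_real//.
  have ei0 : 0 < e^-1 by rewrite invr_gt0.
  nra.
(* The shift moves [k] by exactly [k x <= e] everywhere, so the result should be a unit, yet it
   vanishes at [x]. *)
have /ring_units_B1P/(_ x)/eqP[] : ring_units (k - B1_cst (k x)).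
  apply: eU => y; rewrite !B1_funE opprB addrCA subrr addr0.
  have kx0 : 0 < k x by rewrite invr_gt0.
  by rewrite (gtr0_norm kx0).
by rewrite !B1_funE subrr.
Qed.

End B1Theory.

Theorem theorem2p6 (R : realType) (X : topologicalType) :
  [<-> [set: B1 X R] = @B1_bounded X R;
       topological_ring (B1 X R);
       open (@ring_units (B1 X R))].
Proof.
tfae=> [bd|[_ _ mulc]|uo].
- split; [exact: B1_addr_continuous|exact: B1_oppr_continuous|].
  by apply: B1_mulr_continuous => f; rewrite -bd.
- exact/open_ring_units_B1/B1_mulr_continuous_bounded.
- apply/seteqP; split=> f // _.
  exact: open_ring_units_B1_bounded.
Qed.
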